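(* For tropical polynomials in one variable, the monomial complexity and the factorization complexity are equal for any nontrivial factorization: if $g=h_1\odot\cdots\odot h_m$ is a nontrivial factorization of a tropical polynomial $g:\mathbb{R}\to\mathbb{R}$, then $\mathrm{mComp}(g)=\mathrm{fComp}(h_1,\dots,h_m)$. On the other hand, there exist tropical polynomials $g,h$ in two variables with irreducible factorizations $g=g_1\odot\cdots\odot g_n$ and $h=h_1\odot\cdots\odot h_m$ such that $\mathrm{mComp}(g)<\mathrm{mComp}(h)$ whereas $\mathrm{fComp}(g_1,\dots,g_n)>\mathrm{fComp}(h_1,\dots,h_m)$.
   Context: A tropical polynomial on $\mathbb{R}^d$ is a function $g(x)=\max_{1\le i\le n}(\langle b_i,x\rangle+a_i)$ with $a_i\in\mathbb{R}$ and arbitrary real exponent vectors $b_i\in\mathbb{R}^d$; $g\odot h$ denotes $g+h$ and $g^{\odot\alpha}$ denotes $\alpha g$. $\mathrm{mComp}(g)$ is the number of linear regions of $g$ (the maximal regions on which $g$ is affine). A factorization of $g$ is a representation $g=h_1\odot\cdots\odot h_m$ as a product of tropical polynomials; it is nontrivial if none of the factors is a power $g^{\odot\alpha}$ of $g$ (with the trivial expression $g=g$ allowed for irreducible $g$). Its factorization complexity is $\mathrm{fComp}(h_1,\dots,h_m)=\sum_{i=1}^m\mathrm{mComp}(h_i)-(m-1)$. A factorization is irreducible if each of its factors is irreducible, meaning that (up to linear, i.e. affine, factors) it admits no nontrivial factorization.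
   Formalization: ''Nontrivial'' also requires that no two factors share a non-affine tropical factor; without this the one-variable claim fails, e.g. max(0,x) ⊙ (max(0,x)+max(0,x−1)) has mComp 3 but fComp 4. *)

(* Defs.v *)
From mathcomp Require Import all_boot all_order all_algebra.
From mathcomp Require Import finmap.
From mathcomp Require Import all_classical all_reals all_analysis.

Set Implicit Arguments.
Unset Strict Implicit.
Unset Printing Implicit Defensive.

Import Order.TTheory GRing.Theory Num.Theory.
Import numFieldNormedType.Exports.

Local Open Scope classical_set_scope.
Local Open Scope ring_scope.

(* Tropical polynomials are treated as functions, so all the notions below
   depend on the function only and not on a choice of monomials. *)

Definition affine_form (R : realType) (d : nat) (b : 'rV[R]_d) (a : R)
    (x : 'rV[R]_d) : R :=
  \sum_(k < d) b 0 k * x 0 k + a.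

Definition tropical_polynomial (R : realType) (d : nat)
    (g : 'rV[R]_d -> R) : Prop :=
  exists (n : nat) (b : 'I_n.+1 -> 'rV[R]_d) (a : 'I_n.+1 -> R),
    forall x, g x = \big[Num.max/affine_form (b ord0) (a ord0) x]_(i < n.+1)
                      affine_form (b i) (a i) x.

Definition affine_on (R : realType) (d : nat) (A : set 'rV[R]_d)
    (g : 'rV[R]_d -> R) : Prop :=
  exists (b : 'rV[R]_d) (a : R), forall x, A x -> g x = affine_form b a x.

(* A region is a nonempty connected open set; passing to closures gives the
   usual full-dimensional closed cells, hence the same count. *)
Definition linear_region (R : realType) (d : nat) (g : 'rV[R]_d -> R)
    (A : set 'rV[R]_d) : Prop :=
  [/\ A !=set0, open A, connected A, affine_on A g &
      forall B : set 'rV[R]_d, open B -> connected B -> affine_on B g ->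
        A `<=` B -> B = A].

(* The set of regions of a tropical polynomial is finite; fset_set would
   return the empty set on an infinite one. *)
Definition mComp (R : realType) (d : nat) (g : 'rV[R]_d -> R) : nat :=
  #|` fset_set [set A | linear_region g A] |%fset.

(* The subtraction is not truncated for a factorization into m > 0 tropical
   polynomials, each of which has at least one region. *)
Definition fComp (R : realType) (d m : nat) (h : 'I_m -> 'rV[R]_d -> R) : nat :=
  (\sum_(i < m) mComp (h i) - (m - 1))%N.

Definition factorization (R : realType) (d m : nat) (g : 'rV[R]_d -> R)
    (h : 'I_m -> 'rV[R]_d -> R) : Prop :=
  [/\ (0 < m)%N, forall i, tropical_polynomial (h i) &
      forall x, g x = \sum_(i < m) h i x].

Definition tropical_power (R : realType) (d : nat) (g f : 'rV[R]_d -> R) : Prop :=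
  exists alpha : R, 0 < alpha /\ forall x, f x = alpha * g x.

Definition tropical_power_mod_affine (R : realType) (d : nat)
    (g f : 'rV[R]_d -> R) : Prop :=
  exists (alpha : R) (b : 'rV[R]_d) (a : R),
    0 < alpha /\ forall x, f x = alpha * g x + affine_form b a x.

(* Affine functions are the units: they are irreducible for this definition,
   and an affine factor does not change fComp. *)
Definition irreducible (R : realType) (d : nat) (g : 'rV[R]_d -> R) : Prop :=
  ~ exists (m : nat) (h : 'I_m -> 'rV[R]_d -> R),
      factorization g h /\ forall i, ~ tropical_power_mod_affine g (h i).

Definition tropical_divides (R : realType) (d : nat)
    (f g : 'rV[R]_d -> R) : Prop :=
  exists k : 'rV[R]_d -> R,
    [/\ tropical_polynomial f, tropical_polynomial k &
        forall x, g x = f x + k x].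

Definition pairwise_coprime (R : realType) (d m : nat)
    (h : 'I_m -> 'rV[R]_d -> R) : Prop :=
  forall (i j : 'I_m) (f : 'rV[R]_d -> R), i != j ->
    tropical_divides f (h i) -> tropical_divides f (h j) -> affine_on setT f.

(* Besides excluding powers of g among the factors, a nontrivial factorization
   may not distribute powers of one non-affine polynomial f over several
   factors: f^(s+t) = f^s f^t is a trivial factorization, also when it occurs
   inside a larger product.  Excluding powers of g alone would admit
     max(0,x) + (max(0,x) + max(0,x-1)),
   which has mComp = 3 and fComp = 2 + 3 - 1 = 4, and in any dimension it would
   let fComp grow without bound by splitting a factor f into k copies of f/k.
   The second disjunct is the trivial expression g = g of an irreducible g. *)
Definition nontrivial_factorization (R : realType) (d m : nat)
    (g : 'rV[R]_d -> R) (h : 'I_m -> 'rV[R]_d -> R) : Prop :=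
  [/\ factorization g h, pairwise_coprime h &
      (forall i, ~ tropical_power g (h i)) \/ (m = 1%N /\ irreducible g)].

Definition irreducible_factorization (R : realType) (d m : nat)
    (g : 'rV[R]_d -> R) (h : 'I_m -> 'rV[R]_d -> R) : Prop :=
  nontrivial_factorization g h /\ forall i, irreducible (h i).

(* Main.v *)
(* Convexity drives everything.  If g = l_0 + sum_j max(0, l_j) with
   nonconstant affine forms l_j, then g is strictly convex in the normal
   direction at every zero of an l_j, so its linear regions are exactly the
   nonempty sign cells of the hyperplane arrangement {l_j = 0}.

   In one variable every tropical polynomial has such a form, with kinks
   c_j max(0, x - t_j), c_j > 0 and distinct t_j, hence mComp = 1 + #kinks.
   A kink shared by two factors would be a common nonaffine divisor, so
   coprimality makes the kinks of g the disjoint union of those of the factors.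

   In two variables, a divisor of max(0, l) is c max(0, l) up to an affine
   form, so max(0, l) is irreducible and products of such hinges over n distinct
   lines have fComp = n + 1.  Four parallel lines give mComp = fComp = 5, while
   the grid x = 0, x = 1, y = 0 gives mComp = 6 and fComp = 4. *)

Require Import Defs.
From mathcomp Require Import all_boot all_order all_algebra.
From mathcomp Require Import finmap.
From mathcomp Require Import all_classical all_reals all_analysis.
From mathcomp Require Import ring lra.

Set Implicit Arguments.
Unset Strict Implicit.
Unset Printing Implicit Defensive.

Import Order.TTheory GRing.Theory Num.Theory.
Import numFieldNormedType.Exports.

Local Open Scope classical_set_scope.
Local Open Scope ring_scope.

(** * Affine forms and upper envelopes *)

Lemma affine_formDZ (R : realType) (d : nat) (b : 'rV[R]_d) (a : R)
    (x v : 'rV[R]_d) (t : R) :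
  affine_form b a (x + t *: v) = affine_form b a x + t * affine_form b 0 v.
Proof.
rewrite /affine_form addr0 mulr_sumr addrAC -big_split /=; congr (_ + _).
by apply: eq_bigr => k _; rewrite !mxE; ring.
Qed.

Lemma affine_formD (R : realType) (d : nat) (b b' : 'rV[R]_d) (a a' : R)
    (x : 'rV[R]_d) :
  affine_form (b + b') (a + a') x = affine_form b a x + affine_form b' a' x.
Proof.
rewrite /affine_form addrACA -big_split /=; congr (_ + _).
by apply: eq_bigr => k _; rewrite !mxE mulrDl.
Qed.

Lemma affine_form0 (R : realType) (d : nat) (a : R) (x : 'rV[R]_d) :
  affine_form 0 a x = a.
Proof.
by rewrite /affine_form big1 ?add0r // => k _; rewrite mxE mul0r.
Qed.

Lemma affine_form_self_gt0 (R : realType) (d : nat) (b : 'rV[R]_d) :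
  b != 0 -> 0 < affine_form b 0 b.
Proof.
move=> b0; rewrite /affine_form addr0 lt_neqAle eq_sym.
have b2 (k : 'I_d) : 0 <= b 0 k * b 0 k by rewrite -expr2 sqr_ge0.
rewrite sumr_ge0 // andbT; apply: contra b0 => /eqP/psumr_eq0P bk.
apply/eqP/rowP => k; rewrite mxE.
by apply/eqP; rewrite -[_ == _]orbb -mulf_eq0; apply/eqP/bk.
Qed.

Lemma affine_form_surj (R : realType) (d : nat) (b : 'rV[R]_d) (a r : R) :
  b != 0 -> exists x, affine_form b a x = r.
Proof.
move=> /affine_form_self_gt0 b0.
exists (0 + ((r - affine_form b a 0) / affine_form b 0 b) *: b).
by rewrite affine_formDZ divfK ?gt_eqF // addrC subrK.
Qed.

(** The maximum is described by its two properties, bound and attainment, so that proofs can avoid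
    iterated [Num.max]. Attainment forces [s] to be nonempty. *)
Definition upper_envelope (R : realType) (d : nat) (s : seq ('rV[R]_d * R))
    (f : 'rV[R]_d -> R) : Prop :=
  forall x, (forall p, p \in s -> affine_form p.1 p.2 x <= f x) /\
            exists2 p, p \in s & f x = affine_form p.1 p.2 x.

Lemma tropicalP (R : realType) (d : nat) (f : 'rV[R]_d -> R) :
  tropical_polynomial f <-> exists s, upper_envelope s f.
Proof.
split=> [[n [b [a fE]]]|[s sf]].
  exists [seq (b i, a i) | i <- enum 'I_n.+1] => x; split=> [p /mapP[i _ ->]|].
    by rewrite fE; exact: (le_bigmax _ (fun i => affine_form (b i) (a i) x)).
  pose F i := affine_form (b i) (a i) x.
  have [[i iE]|jE] : (exists i, f x = F i) \/ f x = F ord0.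
    rewrite fE; elim/big_ind: _ => [|u v uE vE|i _]; first by right.
      by case: (leP u v).
    by left; exists i.
  - by exists (b i, a i) => //; apply: (map_f (fun i => (b i, a i))); rewrite mem_enum.
  - by exists (b ord0, a ord0) => //;
      apply: (map_f (fun i => (b i, a i))); rewrite mem_enum.
have [_ [p0 p0s _]] := sf 0.
(* The pieces are indexed by ['I_n.+1], and [s] is nonempty, so [n] is one less than its size. *)
exists (size s).-1, (fun i => (nth p0 s i).1), (fun i => (nth p0 s i).2) => x.
have sn : (size s).-1.+1 = size s by case: (s) p0s.
have [ub [p ps fp]] := sf x.
apply/eqP; rewrite eq_le; apply/andP; split.
  move: (ps); rewrite -index_mem -sn => ip; rewrite fp.
  rewrite -{1 2}(nth_index p0 ps).
  exact: (le_bigmax _ (fun i : 'I_(size s).-1.+1 => affine_form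
    (nth p0 s i).1 (nth p0 s i).2 x) (Ordinal ip)).
apply/bigmax_leP; split=> [|i _]; apply: ub; apply: mem_nth => //.
  by case: (s) p0s.
by rewrite -[X in (_ < X)%N]sn.
Qed.

(** * Convexity and divisors of a hinge *)

Definition hinge (R : realType) (d : nat) (b : 'rV[R]_d) (a : R)
    (x : 'rV[R]_d) : R := Num.max 0 (affine_form b a x).

Lemma tropical_affine_form (R : realType) (d : nat) (b : 'rV[R]_d) (a : R) :
  tropical_polynomial (affine_form b a).
Proof.
apply/tropicalP; exists [:: (b, a)] => x; split=> [p|].
  by rewrite inE => /eqP ->.
by exists (b, a); rewrite ?inE.
Qed.

Lemma tropical_hinge (R : realType) (d : nat) (b : 'rV[R]_d) (a : R) :
  tropical_polynomial (hinge b a).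
Proof.
apply/tropicalP; exists [:: (0, 0); (b, a)] => x; rewrite /hinge; split=> [p|].
  by rewrite !inE => /orP[]/eqP -> /=; rewrite ?affine_form0 le_max lexx ?orbT.
case: (leP 0 (affine_form b a x)) => _.
- by exists (b, a); rewrite ?inE ?eqxx ?orbT.
- by exists (0, 0); rewrite ?inE ?eqxx ?affine_form0.
Qed.

Lemma tropicalD (R : realType) (d : nat) (f g : 'rV[R]_d -> R) :
  tropical_polynomial f -> tropical_polynomial g ->
  tropical_polynomial (fun x => f x + g x).
Proof.
move=> /tropicalP[s sf] /tropicalP[u ug]; apply/tropicalP.
exists [seq (p.1 + q.1, p.2 + q.2) | p <- s, q <- u] => x.
have [fub [p ps fp]] := sf x; have [gub [q qu gq]] := ug x; split.
  move=> _ /allpairsP[[p' q'] /= [p's q'u ->]] /=.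
  by rewrite affine_formD lerD ?fub ?gub.
exists (p.1 + q.1, p.2 + q.2); last by rewrite affine_formD fp gq.
by apply/allpairsP; exists (p, q).
Qed.

Lemma tropical_sum (R : realType) (d : nat) (I : Type) (r : seq I) (P : pred I)
    (f : I -> 'rV[R]_d -> R) :
  (forall i, tropical_polynomial (f i)) ->
  tropical_polynomial (fun x => \sum_(i <- r | P i) f i x).
Proof.
move=> tf; elim: r => [|i r IH].
  have -> : (fun x : 'rV[R]_d => \sum_(i <- [::] | P i) f i x) = affine_form 0 0.
    by apply/funext => x; rewrite big_nil affine_form0.
  exact: tropical_affine_form.
have [Pi|nPi] := boolP (P i).
  have -> : (fun x => \sum_(j <- i :: r | P j) f j x) =
            (fun x => f i x + \sum_(j <- r | P j) f j x).
    by apply/funext => x; rewrite big_cons Pi.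
  exact: tropicalD.
have -> : (fun x => \sum_(j <- i :: r | P j) f j x) =
          (fun x => \sum_(j <- r | P j) f j x).
  by apply/funext => x; rewrite big_cons (negPf nPi).
exact: IH.
Qed.

(** The point [z] is the convex combination of [z - e *: w] and [z + w] with weights 1/(1+e) and
    e/(1+e), and the piece active at [z] bounds [f] from below at both. *)
Lemma tropical_convex (R : realType) (d : nat) (f : 'rV[R]_d -> R)
    (z w : 'rV[R]_d) (e : R) :
  tropical_polynomial f -> 0 <= e ->
  (1 + e) * f z <= f (z - e *: w) + e * f (z + w).
Proof.
move=> /tropicalP[s sf] e0; have [_ [p ps ->]] := sf z.
have [+ _] := sf (z - e *: w) => /(_ _ ps); rewrite -scaleNr affine_formDZ => h1.
have [+ _] := sf (z + w) => /(_ _ ps).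
rewrite -[X in _ + X]scale1r affine_formDZ scale1r => /(ler_wpM2l e0) h2.
by apply: le_trans (lerD h1 h2); rewrite le_eqVlt; apply/orP; left; apply/eqP; ring.
Qed.

(** Every segment from a point [y] of [P] to [x0] continues beyond [x0] to a point of [P]. The sum
    is affine at these three points and both summands are convex, so neither can bend: [f] keeps the
    piece active at [x0]. *)
Lemma tropical_summand_affine (R : realType) (d : nat) (f k : 'rV[R]_d -> R)
    (P : set 'rV[R]_d) (x0 : 'rV[R]_d) :
  tropical_polynomial f -> tropical_polynomial k ->
  P x0 -> (forall y, P y -> exists2 e, 0 < e & P (x0 - e *: (y - x0))) ->
  affine_on P (fun x => f x + k x) -> affine_on P f.
Proof.
move=> tf tk Px0 Pstar [b [a fkE]]; case/tropicalP: (tf) => s sf.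
have [_ [p ps fx0]] := sf x0; exists p.1, p.2 => y Py.
have [e e0 Pe] := Pstar _ Py; set w := y - x0 in Pe.
have yE : y = x0 + w by rewrite /w addrC subrK.
have kc := tropical_convex x0 w tk (ltW e0).
have [+ _] := sf (x0 - e *: w) => /(_ _ ps) fle.
have [+ _] := sf y => /(_ _ ps) ple.
have := fkE _ Px0; have := fkE _ Pe; have := fkE _ Py; rewrite yE in ple *.
move: fle ple kc; rewrite fx0.
set fw := f (_ - _); set kw := k (_ - _); set fy := f (_ + _); set ky := k (_ + _).
rewrite -scaleNr -[in x0 + w](scale1r w) !affine_formDZ => fle ple kc h1 h2 h3.
apply/eqP; rewrite eq_le ple andbT -(ler_pM2l e0).
(* Convexity is an equality for the sum. Since [k] satisfies the inequality and [fw] is at least the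
   piece, [fy] cannot exceed the piece. *)
have : fw + kw + e * (fy + ky) = (1 + e) * (affine_form p.1 p.2 x0 + k x0).
  by rewrite h2 h1 h3; ring.
lra.
Qed.

(** Measures the bending of [f] at [z] along [v]. It is additive in [f], nonnegative for tropical
    polynomials and zero for affine functions, so bends of different summands never cancel. *)
Definition second_diff (R : realType) (d : nat) (f : 'rV[R]_d -> R)
    (z v : 'rV[R]_d) : R := f (z + v) + f (z - v) - 2 * f z.

Lemma second_diff_ge0 (R : realType) (d : nat) (f : 'rV[R]_d -> R)
    (z v : 'rV[R]_d) :
  tropical_polynomial f -> 0 <= second_diff f z v.
Proof.
by move=> tf; have := tropical_convex z v tf ler01; rewrite /second_diff scale1r; lra.
Qed.

Lemma second_diff_affine (R : realType) (d : nat) (f : 'rV[R]_d -> R)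
    (z v : 'rV[R]_d) (b : 'rV[R]_d) (a : R) :
  f (z + v) = affine_form b a (z + v) -> f (z - v) = affine_form b a (z - v) ->
  f z = affine_form b a z -> second_diff f z v = 0.
Proof.
rewrite /second_diff => -> -> ->.
by rewrite -(scaleN1r v) -[in z + v](scale1r v) !affine_formDZ; lra.
Qed.

Lemma second_diff_comb (R : realType) (d : nat) (f : 'rV[R]_d -> R)
    (z v : 'rV[R]_d) (b : 'rV[R]_d) (a c : R) :
  second_diff (fun x => c * f x + affine_form b a x) z v = c * second_diff f z v.
Proof.
have := @second_diff_affine _ _ (affine_form b a) z v b a erefl erefl erefl.
by rewrite /second_diff => h; lra.
Qed.

Lemma second_diff_sum (R : realType) (d : nat) (I : Type) (r : seq I)
    (P : pred I) (f : I -> 'rV[R]_d -> R) (z v : 'rV[R]_d) :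
  second_diff (fun x => \sum_(i <- r | P i) f i x) z v =
  \sum_(i <- r | P i) second_diff (f i) z v.
Proof. by rewrite /second_diff mulr_sumr -sumrN -!big_split. Qed.

Lemma second_diff_hinge (R : realType) (d : nat) (b z : 'rV[R]_d) (a t : R) :
  b != 0 -> 0 < t -> affine_form b a z = 0 ->
  0 < second_diff (hinge b a) z (t *: b).
Proof.
move=> /affine_form_self_gt0 b0 t0 z0.
rewrite /second_diff /hinge -scaleNr !affine_formDZ z0 !add0r mulNr maxxx mulr0 subr0.
have tb := mulr_gt0 t0 b0.
by rewrite (max_r (ltW tb)) max_l ?addr0 // oppr_le0 ltW.
Qed.

(** The divisor is affine on each closed half-space, where the hinge is. The two affine pieces agree
    on the hyperplane, hence differ by a multiple [c] of its form, and convexity across it gives the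
    sign of [c]. *)
Lemma hinge_divisor (R : realType) (d : nat) (b : 'rV[R]_d) (a : R)
    (f : 'rV[R]_d -> R) :
  b != 0 -> tropical_divides f (hinge b a) ->
  exists (c : R) (b' : 'rV[R]_d) (a' : R), 0 <= c /\
    forall x, f x = c * hinge b a x + affine_form b' a' x.
Proof.
move=> b0 [k [tf tk fkE]]; pose l := affine_form b a.
have b2 := affine_form_self_gt0 b0.
have lDZ x v t : l (x + t *: v) = l x + t * affine_form b 0 v.
  exact: affine_formDZ.
have l_sub x y e : l (x - e *: (y - x)) = l x - e * (l y - l x).
  rewrite -[in RHS](subrK x y) [in RHS](addrC (y - x)) -[in RHS](scale1r (y - x)).
  by rewrite -scaleNr !lDZ; ring.
(* Base points inside the two half-spaces, from which segments can be prolonged, and one on the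
   hyperplane. *)
have [x1 x1E] : exists x, l x = 1 by exact: affine_form_surj.
have [x2 x2E] : exists x, l x = -1 by exact: affine_form_surj.
have [z zE] : exists x, l x = 0 by exact: affine_form_surj.
have [bp [ap fp]] : affine_on [set x | 0 <= l x] f.
  apply: (tropical_summand_affine (x0 := x1) tf tk) => /= [|y yP|].
  - by rewrite x1E.
  (* With this [e] the prolonged point has [l] equal to 2 / (1 + l y), which is positive. *)
  - exists (1 + l y)^-1; first by rewrite invr_gt0; lra.
    rewrite l_sub x1E subr_ge0 mulrC ler_pdivrMr; lra.
  - by exists b, a => x /= lx; rewrite -fkE /hinge max_r.
have [bq [aq fq]] : affine_on [set x | l x <= 0] f.
  apply: (tropical_summand_affine (x0 := x2) tf tk) => /= [|y yP|].
  - by rewrite x2E; lra.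
  - exists (1 - l y)^-1; first by rewrite invr_gt0; lra.
    rewrite l_sub x2E subr_le0 mulrC ler_pdivlMr; lra.
  - by exists 0, 0 => x /= lx; rewrite -fkE /hinge affine_form0 max_l.
pose lp := affine_form bp 0 b; pose lq := affine_form bq 0 b.
pose c := (lp - lq) / affine_form b 0 b.
have pq x : affine_form bp ap x = c * l x + affine_form bq aq x.
  (* The orthogonal projection of [x] to the hyperplane, where both pieces equal [f]. *)
  pose y := x + (- (l x / affine_form b 0 b)) *: b.
  have ly : l y = 0 by rewrite /y lDZ mulNr divfK ?gt_eqF ?subrr.
  have := fq y; have := fp y; rewrite /= ly lexx => /(_ isT) -> /(_ isT).
  rewrite !affine_formDZ -/lp -/lq /c => h.
  have -> : affine_form bp ap x = affine_form bq aq x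
    - (l x / affine_form b 0 b) * lq + (l x / affine_form b 0 b) * lp by lra.
  ring.
exists c, bq, aq; split=> [|x]; last first.
  rewrite /hinge; case: (leP 0 (affine_form b a x)) => lx; first by rewrite fp ?pq.
  by rewrite mulr0 add0r fq //= ltW.
have := second_diff_ge0 z b tf; rewrite /second_diff.
rewrite -(scaleN1r b) -[in z + b](scale1r b) (fp (_ + 1 *: _)) /=; last first.
  by rewrite lDZ zE; lra.
rewrite (fq (_ + -1 *: _)) /=; last by rewrite lDZ zE; lra.
rewrite (fq z) /= ?zE // pq !affine_formDZ -/lq lDZ zE => h.
by rewrite -(pmulr_lge0 _ b2); lra.
Qed.

(** A factor that is no power of the hinge modulo affine forms must have coefficient 0, hence be
    affine. Affine factors alone cannot produce the bend of the hinge on its hyperplane. *)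
Lemma irreducible_hinge (R : realType) (d : nat) (b : 'rV[R]_d) (a : R) :
  b != 0 -> irreducible (hinge b a).
Proof.
move=> b0 [m [h [[m0 th hE] npow]]].
have [z zE] := affine_form_surj a 0 b0.
have := second_diff_hinge b0 ltr01 zE; set v := 1 *: b.
have -> : hinge b a = (fun x => \sum_(i < m) h i x) by exact/funext.
rewrite second_diff_sum big1 ?ltxx // => i _.
have [|c [b' [a' [c0 hiE]]]] := @hinge_divisor _ _ b a (h i) b0.
  exists (fun x => \sum_(j < m | j != i) h j x); split=> //.
  - exact: tropical_sum.
  - by move=> x; rewrite hE (bigD1 i).
have -> : h i = (fun x => c * hinge b a x + affine_form b' a' x) by exact/funext.
rewrite second_diff_comb; have [->|cn0] := eqVneq c 0; first by rewrite mul0r.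
by case: (npow i); exists c, b', a'; rewrite lt_neqAle eq_sym cn0 c0.
Qed.

(** * Linear regions as cells of a hyperplane arrangement *)

Lemma affine_form_continuous (R : realType) (d : nat) (b : 'rV[R]_d.+1) (a : R) :
  continuous (affine_form b a).
Proof.
have sc : continuous (fun x : 'rV_d.+1 => \sum_(k < d.+1) b 0 k * x 0 k).
  apply: (continuous_big (op := +%R)); first exact: add_continuous.
  move=> k _ x; apply: continuousM; first exact: cst_continuous.
  exact: coord_continuous.
by move=> x; exact: (@continuousD _ _ _ _ (fun=> a) x (sc x) (@cst_continuous _ _ a x)).
Qed.

Lemma line_continuous (R : realType) (d : nat) (x v : 'rV[R]_d.+1) :
  continuous (fun t : R => x + t *: v).
Proof.
move=> t; exact: (@continuousD _ _ _ (fun=> x) _ t (@cst_continuous _ _ x t)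
  (@scalel_continuous _ _ v t)).
Qed.

Lemma open_line_symmetric (R : realType) (d : nat) (B : set 'rV[R]_d.+1)
    (x v : 'rV[R]_d.+1) :
  open B -> B x -> exists2 t : R, 0 < t & B (x + t *: v) /\ B (x - t *: v).
Proof.
move=> oB Bx.
have /(_ 0) := @line_continuous _ _ x v; rewrite /prop_for/continuous_at /= => h.
have nB : nbhs (x + 0 *: v) B by rewrite scale0r addr0; exact: open_nbhs_nbhs.
have /nbhs_ballP[e /= e0 eB] := h _ nB.
have e2 : 0 < e / 2 by rewrite divr_gt0.
exists (e / 2) => //; split; last rewrite -scaleNr; apply: eB => /=.
  by rewrite /ball /= sub0r normrN gtr0_norm //; lra.
by rewrite /ball /= sub0r opprK gtr0_norm //; lra.
Qed.

(** The open cell of a sign vector, possibly empty. Coding signs as a finite function makes regions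
    countable as a finite set. *)
Definition cell (R : realType) (d : nat) (J : finType) (b : J -> 'rV[R]_d)
    (a : J -> R) (s : {ffun J -> bool}) : set 'rV[R]_d :=
  [set x | forall j, if s j then 0 < affine_form (b j) (a j) x
                     else affine_form (b j) (a j) x < 0].

Lemma cell_inj (R : realType) (d : nat) (J : finType) (b : J -> 'rV[R]_d)
    (a : J -> R) (s s' : {ffun J -> bool}) (x : 'rV[R]_d) :
  cell b a s x -> cell b a s' x -> s = s'.
Proof.
move=> sx s'x; apply/ffunP => j; move: (sx j) (s'x j).
by case: (s j) (s' j) => [] []//; lra.
Qed.

Lemma open_cell (R : realType) (d : nat) (J : finType) (b : J -> 'rV[R]_d.+1)
    (a : J -> R) (s : {ffun J -> bool}) : open (cell b a s).
Proof.
rewrite openE => x sx; apply: (@filter_forall _ J (fun j y => if s j then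
  0 < affine_form (b j) (a j) y else affine_form (b j) (a j) y < 0) (nbhs x)) => j.
have /continuousP lC := @affine_form_continuous R d (b j) (a j).
have := sx j; case: (s j) => lx; apply: open_nbhs_nbhs; split=> //.
  exact: (lC _ (@open_gt R 0)).
exact: (lC _ (@open_lt R 0)).
Qed.

Lemma connected_cell (R : realType) (d : nat) (J : finType)
    (b : J -> 'rV[R]_d.+1) (a : J -> R) (s : {ffun J -> bool}) :
  connected (cell b a s).
Proof.
have [->|/set0P[x0 sx0]] := eqVneq (cell b a s) set0; first exact: connected0.
have -> : cell b a s = \bigcup_(y in cell b a s)
    ((fun t : R => x0 + t *: (y - x0)) @` `[0, 1]).
  rewrite eqEsubset; split=> [y sy|_ [y sy [t /= t01 <-]] j].
    exists y => //; exists 1; first by rewrite /= in_itv /= ler01 lexx.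
    by rewrite scale1r addrC subrK.
  have := affine_formDZ (b j) (a j) x0 (y - x0) 1.
  rewrite scale1r [x0 + _]addrC subrK affine_formDZ mul1r.
  move: (sx0 j) (sy j) t01; rewrite in_itv /=.
  set u := affine_form _ _ x0; set w := affine_form _ _ y.
  set r := affine_form _ _ (y - x0); case: (s j) => u0 w0 /andP[t0 t1] rE.
    (* A common positive lower bound at both ends also bounds the convex combination from below. *)
    have [m [m0 mu mw]] : exists m, [/\ 0 < m, m <= u & m <= w].
      by exists (Num.min u w); rewrite lt_min u0 w0 !ge_min !lexx orbT.
    nra.
  have [m [m0 mu mw]] : exists m, [/\ m < 0, u <= m & w <= m].
    by exists (Num.max u w); rewrite gt_max u0 w0 !le_max !lexx orbT.
  nra.
apply: bigcup_connected.
  by exists x0 => y _; exists 0; rewrite /= ?in_itv /= ?lexx ?ler01 // scale0r addr0.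
move=> y _; apply: connected_continuous_connected; first exact: segment_connected.
exact/continuous_subspaceT/line_continuous.
Qed.

Lemma connected_affine_form_sign (R : realType) (d : nat) (B : set 'rV[R]_d.+1)
    (b : 'rV[R]_d.+1) (a : R) (x y : 'rV[R]_d.+1) :
  connected B -> (forall z, B z -> affine_form b a z != 0) -> B x -> B y ->
  0 < affine_form b a x -> 0 < affine_form b a y.
Proof.
move=> cB nz Bx By lx; rewrite ltNge; apply/negP => ly.
have /connected_intervalP itv : connected [set affine_form b a z | z in B].
  apply: connected_continuous_connected => //.
  exact/continuous_subspaceT/affine_form_continuous.
have [z Bz z0] : [set affine_form b a z | z in B] 0.
  apply: (itv (affine_form b a y) (affine_form b a x)); [by exists y|by exists x|].
  by rewrite ly ltW.
by have := nz _ Bz; rewrite z0 eqxx.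
Qed.

Definition hinge_sum (R : realType) (d : nat) (J : finType) (b0 : 'rV[R]_d)
    (a0 : R) (b : J -> 'rV[R]_d) (a : J -> R) (x : 'rV[R]_d) : R :=
  affine_form b0 a0 x + \sum_j hinge (b j) (a j) x.

Lemma tropical_hinge_sum (R : realType) (d : nat) (J : finType)
    (b0 : 'rV[R]_d) (a0 : R) (b : J -> 'rV[R]_d) (a : J -> R) :
  tropical_polynomial (hinge_sum b0 a0 b a).
Proof.
apply: tropicalD; first exact: tropical_affine_form.
by apply: tropical_sum => j; exact: tropical_hinge.
Qed.

(** The affine part contributes zero, and the other hinges contribute nonnegative amounts. *)
Lemma second_diff_hinge_sum (R : realType) (d : nat) (J : finType)
    (b0 : 'rV[R]_d) (a0 : R) (b : J -> 'rV[R]_d) (a : J -> R)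
    (z v : 'rV[R]_d) (j : J) :
  second_diff (hinge (b j) (a j)) z v <= second_diff (hinge_sum b0 a0 b a) z v.
Proof.
have h : second_diff (affine_form b0 a0) z v = 0 by exact: second_diff_affine.
have -> : second_diff (hinge_sum b0 a0 b a) z v =
    second_diff (affine_form b0 a0) z v +
    second_diff (fun x => \sum_j hinge (b j) (a j) x) z v.
  by rewrite /second_diff /hinge_sum; lra.
rewrite h add0r second_diff_sum (bigD1 j) //= lerDl.
by apply: sumr_ge0 => i _; apply: second_diff_ge0; exact: tropical_hinge.
Qed.

Lemma affine_on_cell (R : realType) (d : nat) (J : finType) (b0 : 'rV[R]_d)
    (a0 : R) (b : J -> 'rV[R]_d) (a : J -> R) (s : {ffun J -> bool}) :
  affine_on (cell b a s) (hinge_sum b0 a0 b a).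
Proof.
exists (b0 + \sum_(j | s j) b j), (a0 + \sum_(j | s j) a j) => x sx.
rewrite affine_formD; congr (_ + _); rewrite (bigID s) /= [X in _ + X]big1.
  rewrite addr0; transitivity (\sum_(j | s j) affine_form (b j) (a j) x).
    by apply: eq_bigr => j sj; rewrite /hinge max_r // ltW //; have := sx j; rewrite sj.
  elim/big_rec3: _ => [|j u v w _ ->]; first by rewrite affine_form0.
  by rewrite affine_formD.
move=> j /negPf sj; have := sx j; rewrite sj /hinge => lx.
by rewrite max_l // ltW.
Qed.

(* A zero of some affine form inside B would make the second difference along
   its normal positive, so all the forms keep a constant sign on B. *)
Lemma affine_sub_cell (R : realType) (d : nat) (J : finType)
    (b0 : 'rV[R]_d.+1) (a0 : R) (b : J -> 'rV[R]_d.+1) (a : J -> R)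
    (B : set 'rV[R]_d.+1) (x : 'rV[R]_d.+1) :
  (forall j, b j != 0) -> open B -> connected B -> B x ->
  affine_on B (hinge_sum b0 a0 b a) ->
  exists s : {ffun J -> bool}, B `<=` cell b a s.
Proof.
move=> bn0 oB cB Bx [b1 [a1 gE]].
have nz j z : B z -> affine_form (b j) (a j) z != 0.
  move=> Bz; apply/eqP => jz.
  have [t t0 [Bp Bm]] := open_line_symmetric (b j) oB Bz.
  have := second_diff_hinge (bn0 j) t0 jz; apply/negP; rewrite -leNgt.
  rewrite (le_trans (second_diff_hinge_sum b0 a0 b a z _ j)) //.
  by rewrite (second_diff_affine (gE _ Bp) (gE _ Bm) (gE _ Bz)).
exists [ffun j => 0 < affine_form (b j) (a j) x] => y By j; rewrite ffunE.
case: ifPn => jx; first exact: (connected_affine_form_sign cB (nz j) Bx By jx).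
rewrite lt_neqAle nz //= leNgt; apply: contra jx => jy.
exact: (connected_affine_form_sign cB (nz j) By Bx jy).
Qed.

(** Any nonempty connected open set on which the sum is affine lies in one cell, and cells are
    themselves such sets, so the maximal ones are the nonempty cells. *)
Lemma linear_region_hinge_sum (R : realType) (d : nat) (J : finType)
    (b0 : 'rV[R]_d.+1) (a0 : R) (b : J -> 'rV[R]_d.+1) (a : J -> R)
    (A : set 'rV[R]_d.+1) : (forall j, b j != 0) ->
  linear_region (hinge_sum b0 a0 b a) A <->
  exists2 s, A = cell b a s & cell b a s !=set0.
Proof.
move=> bn0; split=> [[[x Ax] oA cA aA Amax]|[s -> s0]].
  have [s As] := affine_sub_cell bn0 oA cA Ax aA.
  exists s; last by exists x; exact: As.
  by rewrite (Amax (cell b a s)) //;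
    [exact: open_cell|exact: connected_cell|exact: affine_on_cell].
split=> //; [exact: open_cell|exact: connected_cell|exact: affine_on_cell|].
move=> B oB cB aB sB; case: s0 => x sx.
have [s' Bs'] := affine_sub_cell bn0 oB cB (sB _ sx) aB.
by rewrite eqEsubset; split=> // y /Bs'; rewrite -(cell_inj sx (Bs' _ (sB _ sx))).
Qed.

Lemma mComp_hinge_sum (R : realType) (d : nat) (J : finType)
    (b0 : 'rV[R]_d.+1) (a0 : R) (b : J -> 'rV[R]_d.+1) (a : J -> R) :
  (forall j, b j != 0) ->
  mComp (hinge_sum b0 a0 b a) =
  #|[set s : {ffun J -> bool} | `[< cell b a s !=set0 >]]%SET|.
Proof.
move=> bn0; rewrite /mComp.
set S := [set s : {ffun J -> bool} | _]%SET.
(* Exhibiting the regions as a finite set rules out the default value of [fset_set]. *)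
have -> : [set A | linear_region (hinge_sum b0 a0 b a) A] =
    [set` [fset cell b a s | s in S]%fset].
  apply/seteqP; split=> A /=.
    move=> /(linear_region_hinge_sum _ _ _ _ bn0)[s -> s0].
    by apply/imfsetP; exists s => //=; rewrite inE; exact/asboolP.
  move=> /imfsetP[s /=]; rewrite inE => /asboolP s0 ->.
  by apply/(linear_region_hinge_sum _ _ _ _ bn0); exists s.
rewrite set_fsetK card_in_imfset /=; first by rewrite cardE.
move=> s s' sS _ ss';
have /asboolP[x sx] : `[< cell b a s !=set0 >] by move: sS; rewrite !inE.
have s'x : cell b a s' x by rewrite -ss'.
exact: cell_inj sx s'x.
Qed.

(** * Counting the cells of parallel hyperplanes *)

Lemma exists_between_seq (R : realType) (r : R) (s : seq R) :
  exists2 x, r < x & forall y, y \in s -> r < y -> x < y.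
Proof.
elim: s => [|z s [x rx xs]]; first by exists (r + 1) => //; rewrite ltrDl.
have [rz|zr] := ltP r z; last first.
  by exists x => // y; rewrite inE => /predU1P[->|]; [rewrite ltNge zr|exact: xs].
exists (Num.min x ((r + z) / 2)); first by rewrite lt_min rx /=; lra.
move=> y; rewrite inE gt_min => /predU1P[-> _|ys ry]; last by rewrite xs.
by apply/orP; right; lra.
Qed.

Lemma exists_below_seq (R : realType) (s : seq R) :
  exists x, forall y, y \in s -> x < y.
Proof.
elim: s => [|z s [x xs]]; first by exists 0.
exists (Num.min x (z - 1)) => y; rewrite inE gt_min => /predU1P[->|/xs ->] //.
by apply/orP; right; lra.
Qed.

(** All forms depend on the single coordinate [u], so a cell is an interval between consecutive
    thresholds. It is the leftmost one or starts at exactly one [t i]. *)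
Lemma card_parallel_cells (R : realType) (d : nat) (J : finType)
    (b : J -> 'rV[R]_d) (a : J -> R) (u : 'rV[R]_d -> R) (t c : J -> R) :
  (forall r, exists x, u x = r) -> (forall j, 0 < c j) -> injective t ->
  (forall j x, affine_form (b j) (a j) x = c j * (u x - t j)) ->
  #|[set s : {ffun J -> bool} | `[< cell b a s !=set0 >]]%SET| = #|J|.+1.
Proof.
move=> u_surj c0 t_inj lE.
have cellE x s : cell b a s x <-> forall j, if s j then t j < u x else u x < t j.
  split=> sx j; have := sx j; rewrite lE; case: (s j);
  by rewrite ?pmulr_rgt0 ?pmulr_rlt0 // ?subr_gt0 ?subr_lt0.
(* The sign vector just to the right of [t i]. *)
pose sg (i : J) : {ffun J -> bool} := [ffun j => t j <= t i].
have sg_inj : injective sg.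
  move=> i j ij; apply: t_inj; apply: le_anti.
  have := congr1 (fun s : {ffun J -> bool} => s i) ij.
  have := congr1 (fun s : {ffun J -> bool} => s j) ij.
  by rewrite !ffunE !lexx => -> <-.
pose s0 : {ffun J -> bool} := [ffun=> false].
have -> : [set s : {ffun J -> bool} | `[< cell b a s !=set0 >]]%SET =
    (s0 |: [set sg i | i : J])%SET.
  apply/setP => s; rewrite !inE; apply/asboolP/idP => [[x /cellE sx]|].
    have [[i si]|ns] := pselect (exists i, s i); last first.
      apply/orP; left; apply/eqP/ffunP => j; rewrite ffunE.
      by apply/negP => sj; apply: ns; exists j.
    (* The largest threshold to the left of [x] identifies its cell. *)
    apply/orP; right; apply/imsetP; exists [arg max_(j > i | s j) t j]%O => //.
    case: arg_maxP => // k sk kmax; apply/ffunP => j; rewrite ffunE.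
    apply/idP/idP => [/kmax//|jk]; apply/negPn/negP => nsj.
    by have := sx j; have := sx k; rewrite sk (negPf nsj); lra.
  move=> /predU1P[->|/imsetP[i _ ->]].
    have [r rP] := exists_below_seq (codom t); have [x xr] := u_surj r.
    by exists x; apply/cellE => j; rewrite ffunE xr rP ?codom_f.
  have [r ir rP] := exists_between_seq (t i) (codom t); have [x xr] := u_surj r.
  exists x; apply/cellE => j; rewrite ffunE xr.
  by case: (leP (t j) (t i)) => ij;
    [exact: le_lt_trans ij ir|apply: rP => //; exact: codom_f].
rewrite cardsU1 card_imset // (_ : s0 \notin _) //.
by apply/imsetP => -[i _ /ffunP/(_ i)]; rewrite !ffunE lexx.
Qed.

(** * One variable *)

(** [t] lists the kink positions and [c] the slope jumps, with c (x - t) coded as an affine form so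
    that the results on arrangements apply. *)
Definition kink_sum (R : realType) (J : finType) (b0 : 'rV[R]_1) (a0 : R)
    (t c : J -> R) : 'rV[R]_1 -> R :=
  hinge_sum b0 a0 (fun j => const_mx (c j)) (fun j => - (c j * t j)).

Lemma affine_form_kink (R : realType) (c t : R) (x : 'rV[R]_1) :
  affine_form (const_mx c) (- (c * t)) x = c * (x 0 0 - t).
Proof. by rewrite /affine_form big_ord1 mxE mulrBr. Qed.

Lemma hinge_kink (R : realType) (c t : R) (x : 'rV[R]_1) :
  0 <= c -> hinge (const_mx c) (- (c * t)) x = c * Num.max 0 (x 0 0 - t).
Proof. by move=> c0; rewrite /hinge affine_form_kink maxr_pMr ?mulr0. Qed.

Lemma const_mx_neq0 (R : realType) (c : R) :
  0 < c -> (const_mx c : 'rV[R]_1) != 0.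
Proof.
by move=> c0; apply: contraTneq c0 => /rowP/(_ 0); rewrite !mxE => ->; rewrite ltxx.
Qed.

Lemma mComp_kink_sum (R : realType) (J : finType) (b0 : 'rV[R]_1) (a0 : R)
    (t c : J -> R) :
  (forall j, 0 < c j) -> injective t -> mComp (kink_sum b0 a0 t c) = #|J|.+1.
Proof.
move=> c0 t_inj; rewrite /kink_sum mComp_hinge_sum => [|j]; last exact: const_mx_neq0.
apply: (@card_parallel_cells _ _ _ _ _ (fun x => x 0 0) t c) => //.
  by move=> r; exists (const_mx r); rewrite mxE.
by move=> j x; rewrite affine_form_kink.
Qed.

Lemma hinge_divides_kink_sum (R : realType) (J : finType) (b0 : 'rV[R]_1)
    (a0 : R) (t c : J -> R) (i : J) (e : R) :
  (forall j, 0 < c j) -> 0 < e <= c i ->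
  tropical_divides (hinge (const_mx e) (- (e * t i))) (kink_sum b0 a0 t c).
Proof.
(* The cofactor has the jump at kink [i] lowered by [e], possibly to 0. *)
move=> c0 /andP[e0 ec]; pose c' j := if j == i then c j - e else c j.
exists (kink_sum b0 a0 t c'); split; [exact: tropical_hinge|exact: tropical_hinge_sum|].
move=> x; rewrite /kink_sum /hinge_sum addrCA; congr (_ + _).
rewrite (bigD1 i) //= [in RHS](bigD1 i) //= addrA; congr (_ + _); last first.
  by apply: eq_bigr => j ji; rewrite /c' (negPf ji).
rewrite /c' eqxx !hinge_kink ?subr_ge0 //; try exact: ltW.
by rewrite mulrBl addrC subrK.
Qed.

Lemma hinge_not_affine (R : realType) (d : nat) (b : 'rV[R]_d) (a : R) :
  b != 0 -> ~ affine_on setT (hinge b a).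
Proof.
move=> b0 [b' [a' hE]]; have [z zE] := affine_form_surj a 0 b0.
have := second_diff_hinge b0 ltr01 zE.
by rewrite (@second_diff_affine _ _ _ _ _ b' a') ?ltxx //; exact: hE.
Qed.

(** At a kink shared by two different factors, the hinge with the smaller of the two jumps would
    divide both without being affine. *)
Lemma coprime_kinks (R : realType) (m : nat) (h : 'I_m -> 'rV[R]_1 -> R)
    (i i' : 'I_m) (J J' : finType) (b0 b0' : 'rV[R]_1) (a0 a0' : R)
    (t c : J -> R) (t' c' : J' -> R) (j : J) (j' : J') :
  pairwise_coprime h -> h i = kink_sum b0 a0 t c -> h i' = kink_sum b0' a0' t' c' ->
  (forall j, 0 < c j) -> (forall j, 0 < c' j) -> t j = t' j' -> i = i'.
Proof.
move=> hco hiE hi'E c0 c'0 tt'; apply/eqP; apply: contrapT => /negP ii'.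
pose e := Num.min (c j) (c' j'); have e0 : 0 < e by rewrite lt_min c0 c'0.
apply: (hinge_not_affine (const_mx_neq0 e0)).
apply: (hco i i' (hinge (const_mx e) (- (e * t j))) ii').
- by rewrite hiE; apply: hinge_divides_kink_sum; rewrite // e0 ge_min lexx.
- by rewrite hi'E tt'; apply: hinge_divides_kink_sum; rewrite // e0 ge_min lexx orbT.
Qed.

(** * Kink normal form of one-variable tropical polynomials *)

Definition kinks (R : realType) (s : seq (R * R)) (b a r : R) : R :=
  b * r + a + \sum_(p <- s) p.2 * Num.max 0 (r - p.1).

Definition kink_seq (R : realType) (s : seq (R * R)) : bool :=
  uniq [seq p.1 | p <- s] && all (fun p => 0 < p.2) s.

Lemma affine_continuous (R : realType) (m k : R) :
  continuous (fun r : R => m * r + k).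
Proof.
move=> r; exact: (@continuousD _ _ _ ( *%R m) (fun=> k) r (@mulrl_continuous _ m r)
  (@cst_continuous _ _ k r)).
Qed.

Lemma kinks_continuous (R : realType) (s : seq (R * R)) (b a : R) :
  continuous (kinks s b a).
Proof.
have ac (u : R) : continuous (fun _ : R => u) by move=> r; exact: cst_continuous.
have lc := @affine_continuous R b a.
have sc : continuous (fun r : R => \sum_(p <- s) p.2 * Num.max 0 (r - p.1)).
  apply: (continuous_big (op := +%R)); first exact: add_continuous.
  move=> p _; have hc : continuous (fun r : R => r - p.1).
    by move=> r; exact: (@continuousD _ _ _ id (fun=> - p.1) r (fun _ U => U) (ac _ r)).
  have mc : continuous (fun r : R => Num.max 0 (r - p.1)).
    by move=> r; exact: (@continuous_max _ _ (fun=> 0) _ r (ac 0 r) (hc r)).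
  by move=> r; exact: (@continuousM _ _ (fun=> p.2) _ r (ac p.2 r) (mc r)).
by move=> r; exact: (@continuousD _ _ _ _ _ r (lc r) (sc r)).
Qed.

Lemma kinks_split (R : realType) (s : seq (R * R)) (b a t : R) (r : R) :
  kinks s b a r = kinks [seq p <- s | p.1 < t] b a r +
    \sum_(p <- s | t <= p.1) p.2 * Num.max 0 (r - p.1).
Proof.
rewrite /kinks big_filter (bigID (fun p => p.1 < t)) /= addrA; congr (_ + _).
by apply: eq_bigl => p; rewrite leNgt.
Qed.

(** To the right of [t] every retained kink is already active, so the function continues as a
    line. *)
Lemma kinks_right (R : realType) (s : seq (R * R)) (b a t r : R) : t <= r ->
  kinks [seq p <- s | p.1 < t] b a r =
  kinks [seq p <- s | p.1 < t] b a t + (b + \sum_(p <- s | p.1 < t) p.2) * (r - t).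
Proof.
move=> tr; rewrite /kinks !big_filter.
have mE x : t <= x -> \sum_(p <- s | p.1 < t) p.2 * Num.max 0 (x - p.1) =
    (\sum_(p <- s | p.1 < t) p.2) * x - \sum_(p <- s | p.1 < t) p.2 * p.1.
  move=> tx; rewrite mulr_suml -sumrB; apply: eq_bigr => p pt.
  by rewrite max_r ?mulrBr // subr_ge0; apply: le_trans tx; exact: ltW.
by rewrite !mE //; ring.
Qed.

(* The new line crosses the old function from below at a point t; the kinks
   beyond t disappear and t becomes a kink. *)
Lemma kinks_max_line (R : realType) (s : seq (R * R)) (b a m k : R) :
  kink_seq s ->
  (forall x y, x <= y -> kinks s b a y <= kinks s b a x + m * (y - x)) ->
  exists s' b' a', kink_seq s' /\
    forall r, kinks s' b' a' r = Num.max (kinks s b a r) (m * r + k).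
Proof.
move=> s_ok slope; set F := kinks s b a.
(* If the line lies entirely below or entirely above [F], the maximum is [F] or the line. Otherwise
   [F] exceeds the line at some [x0] and is below it at some [y0]. *)
have [ge|/existsNP[y0 /negP]] := pselect (forall r, m * r + k <= F r).
  by exists s, b, a; split=> // r; rewrite max_l.
rewrite -ltNge => y0F.
have [le|/existsNP[x0 /negP]] := pselect (forall r, F r <= m * r + k).
  by exists [::], m, k; split=> // r; rewrite max_r // /kinks big_nil addr0.
rewrite -ltNge => x0F.
have slope' x y : x <= y -> F y - (m * y + k) <= F x - (m * x + k).
  by move=> /slope; rewrite -/F => h; lra.
have x0y0 : x0 <= y0.
  by rewrite leNgt; apply/negP => /ltW/slope'; lra.
have [t _ tE] : exists2 t, t \in `[x0, y0] & (fun r => F r - (m * r + k)) t = 0.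
  apply: IVT => //; last first.
    by rewrite ge_min le_max; apply/andP; split; apply/orP; [right|left]; lra.
  apply: continuous_subspaceT => r.
  exact: (@continuousB _ _ _ F _ r (@kinks_continuous _ _ _ _ r)
    (@affine_continuous _ m k r)).
rewrite /= in tE.
have ty0 : t < y0 by rewrite ltNge; apply/negP => /slope'; lra.
move: s_ok => /andP[s_uniq s_pos].
(* The part of [F] left of [t], continued beyond [t] with its final slope [B]. *)
pose psi := kinks [seq p <- s | p.1 < t] b a.
have psi_le r : psi r <= F r.
  rewrite /F (kinks_split _ _ _ t) lerDl big_seq_cond; apply: sumr_ge0 => p /andP[ps _].
  by rewrite mulr_ge0 ?le_max ?lexx // ltW //; exact: (allP s_pos).
have psiE r : r <= t -> F r = psi r.
  move=> rt; rewrite /F (kinks_split _ _ _ t) big1 ?addr0 // => p tp.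
  by rewrite max_l ?mulr0 // subr_le0; exact: le_trans tp.
set B := b + \sum_(p <- s | p.1 < t) p.2.
have psi_right r : t <= r -> psi r = psi t + B * (r - t) by exact: kinks_right.
have psit := psiE _ (lexx t).
(* [psi] meets the line at [t] and is below it at [y0]. *)
have Bm : B < m.
  by have := psi_le y0; rewrite psi_right ?(ltW ty0) // -psit; nra.
(* The jump [m - B] changes the slope at [t] from [B] to that of the line. *)
exists ((t, m - B) :: [seq p <- s | p.1 < t]), b, a; split.
  rewrite /kink_seq /= subr_gt0 Bm /= -andbA; apply/and3P; split.
  - by apply/mapP => -[p]; rewrite mem_filter => /andP[pt _] tp; rewrite -tp ltxx in pt.
  - by apply: subseq_uniq s_uniq; apply: map_subseq; exact: filter_subseq.
  - by apply/allP => p; rewrite mem_filter => /andP[_ /(allP s_pos)].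
move=> r; rewrite /kinks big_cons /= addrCA -/(kinks _ b a r) -/(psi r).
case: (leP r t) => rt.
  rewrite max_l ?subr_le0 // mulr0 add0r max_l ?psiE //.
  by rewrite -psiE //; have := slope' _ _ rt; lra.
have tr := ltW rt.
rewrite max_r ?subr_ge0 // max_r; first by rewrite psi_right //; lra.
by have := slope' _ _ tr; lra.
Qed.

(** Lines are inserted by increasing slope, the head of the list last. Each new line is then at
    least as steep as the envelope so far, which therefore crosses it at most in one direction. *)
Lemma kinks_envelope (R : realType) (L : seq (R * R)) :
  L != [::] -> sorted (fun p q => q.1 <= p.1) L ->
  exists s b a, kink_seq s /\
    forall r, (forall p, p \in L -> p.1 * r + p.2 <= kinks s b a r) /\
              exists2 p, p \in L & kinks s b a r = p.1 * r + p.2.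
Proof.
elim: L => [//|p L IH _ pL]; have [->|L0] := eqVneq L [::].
  exists [::], p.1, p.2; split=> // r; rewrite /kinks big_nil addr0; split.
    by move=> q; rewrite inE => /eqP ->.
  by exists p; rewrite ?inE.
have [s [b [a [s_ok sL]]]] := IH L0 (path_sorted pL).
have p_max q : q \in L -> q.1 <= p.1.
  have tr : transitive (fun p q : R * R => q.1 <= p.1).
    by move=> x y z /= xy zx; exact: le_trans zx xy.
  exact: (allP (order_path_min tr pL)).
have [||s' [b' [a' [s'_ok s'E]]]] := @kinks_max_line _ s b a p.1 p.2.
- exact: s_ok.
- move=> x y xy; have [_ [q qL ->]] := sL y; have [+ _] := sL x => /(_ _ qL).
  by have := p_max _ qL; nra.
exists s', b', a'; split=> // r; have [ub [q qL qE]] := sL r; rewrite s'E; split.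
  move=> q'; rewrite inE le_max => /predU1P[->|/ub ->] //.
  by rewrite lexx orbT.
case: (leP (kinks s b a r)) => _; first by exists p; rewrite ?inE ?eqxx.
by exists q; rewrite ?inE ?qL ?orbT.
Qed.

(** After sorting by slope, the kink form and [f] are upper envelopes of the same lines, hence
    equal. *)
Lemma tropical_kink_sum (R : realType) (f : 'rV[R]_1 -> R) :
  tropical_polynomial f ->
  exists (s : seq (R * R)) (b0 : 'rV[R]_1) (a0 : R),
    [/\ injective (fun j : 'I_(size s) => (nth (0, 0) s j).1),
        forall j : 'I_(size s), 0 < (nth (0, 0) s j).2 &
        f = kink_sum b0 a0 (fun j : 'I_(size s) => (nth (0, 0) s j).1)
                           (fun j : 'I_(size s) => (nth (0, 0) s j).2)].
Proof.
move=> /tropicalP[u uf].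
pose L := sort (fun p q => q.1 <= p.1) [seq (p.1 0 0, p.2) | p : 'rV[R]_1 * R <- u].
have LP p : p \in u -> (p.1 0 0, p.2) \in L.
  by move=> pu; rewrite mem_sort; apply/mapP; exists p.
have [||s [b [a [/andP[s_uniq s_pos] sE]]]] := @kinks_envelope _ L.
- by have [_ [p /LP]] := uf 0; case: (L).
- by apply: sort_sorted => p q; exact: le_total.
have s_gt0 (j : 'I_(size s)) : 0 < (nth (0, 0) s j).2.
  by apply: (allP s_pos); exact: mem_nth.
exists s, (const_mx b), a; split=> //.
  move=> i j ij; apply: val_inj; apply/eqP.
  rewrite -(nth_uniq 0 _ _ s_uniq) ?size_map ?ltn_ord //.
  by rewrite !(nth_map (0, 0)) ?ltn_ord //; apply/eqP.
apply/funext => x; rewrite /kink_sum /hinge_sum.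
have -> : affine_form (const_mx b) a x = b * x 0 0 + a.
  by rewrite /affine_form big_ord1 mxE.
transitivity (kinks s b a (x 0 0)); last first.
  rewrite /kinks (big_nth (0, 0)) big_mkord; congr (_ + _).
  by apply: eq_bigr => j _; rewrite hinge_kink ?ltW.
have affE (p : 'rV[R]_1 * R) : affine_form p.1 p.2 x = p.1 0 0 * x 0 0 + p.2.
  by rewrite /affine_form big_ord1.
have [ub [p pL pE]] := sE (x 0 0); have [fub [q qu fq]] := uf x.
apply: le_anti; apply/andP; split.
  by rewrite fq affE; exact: (ub _ (LP _ qu)).
rewrite pE; move: pL; rewrite mem_sort => /mapP[q' q'u ->] /=.
by rewrite -affE; exact: fub.
Qed.

Lemma mComp_factorization1 (R : realType) (g : 'rV[R]_1 -> R) (m : nat)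
    (h : 'I_m -> 'rV[R]_1 -> R) :
  factorization g h -> pairwise_coprime h -> mComp g = fComp h.
Proof.
move=> [m0 th gE] hco.
have {th} /choice[w wP] : forall i, exists w : seq (R * R) * 'rV[R]_1 * R,
    [/\ injective (fun j : 'I_(size w.1.1) => (nth (0, 0) w.1.1 j).1),
        forall j : 'I_(size w.1.1), 0 < (nth (0, 0) w.1.1 j).2 &
        h i = kink_sum w.1.2 w.2 (fun j : 'I_(size w.1.1) => (nth (0, 0) w.1.1 j).1)
                           (fun j : 'I_(size w.1.1) => (nth (0, 0) w.1.1 j).2)].
  by move=> i; have [s [b0 [a0 hi]]] := tropical_kink_sum (th i); exists (s, b0, a0).
pose J i := 'I_(size (w i).1.1).
pose t i (j : J i) := (nth (0, 0) (w i).1.1 j).1.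
pose c i (j : J i) := (nth (0, 0) (w i).1.1 j).2.
have t_inj i : injective (@t i) by have [] := wP i.
have c0 i j : 0 < @c i j by have [_ + _] := wP i; apply.
have hE i : h i = kink_sum (w i).1.2 (w i).2 (@t i) (@c i) by have [] := wP i.
(* The kinks of [g] are indexed by the tagged union of those of the factors. *)
have -> : g = kink_sum (\sum_i (w i).1.2) (\sum_i (w i).2)
    (fun p : {i & J i} => t (tag p) (tagged p)) (fun p => c (tag p) (tagged p)).
  apply/funext => x; rewrite gE /kink_sum /hinge_sum.
  have -> : affine_form (\sum_i (w i).1.2) (\sum_i (w i).2) x =
      \sum_i affine_form (w i).1.2 (w i).2 x.
    elim/big_rec3: _ => [|i u v z _ IH]; first by rewrite affine_form0.
    by rewrite affine_formD IH.
  rewrite -(sig_big_dep xpredT (fun _ => xpredT)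
    (fun i j => hinge (const_mx (c i j)) (- (c i j * t i j)) x)) -big_split /=.
  by apply: eq_bigr => i _; rewrite hE.
rewrite mComp_kink_sum => [|[i j]|[i j] [i' j'] /= tt']; last 2 first.
- exact: c0.
(* Coprimality separates kinks of different factors; within one factor positions are distinct by
   construction. *)
- have ii' := coprime_kinks hco (hE i) (hE i') (@c0 i) (@c0 i') tt'.
  by case: _ / ii' in j' tt' *; rewrite (t_inj _ _ _ tt').
have mh i : mComp (h i) = (#|J i| + 1)%N.
  by rewrite hE addn1; apply: mComp_kink_sum; [exact: c0|exact: t_inj].
rewrite /fComp; under eq_bigr do rewrite mh.
rewrite card_tagged sumnE big_map big_enum /=.
(* With [m] positive, adding 1 for each of the [m] factors and subtracting [m - 1] leaves one more
   than the number of kinks. *)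
by rewrite big_split /= sum1_card card_ord subnBA // addnAC addnK addn1.
Qed.

(** * Two variables *)

(** Off its hyperplane a hinge is locally affine, so a short enough step sees no bend. *)
Lemma second_diff_hinge0 (R : realType) (d : nat) (b z v : 'rV[R]_d) (a : R) :
  affine_form b a z != 0 ->
  exists2 t, 0 < t & second_diff (hinge b a) z (t *: v) = 0.
Proof.
move=> z0; set L := affine_form b 0 v; set l := affine_form b a z in z0 *.
have l0 : 0 < `|l| by rewrite normr_gt0.
have L0 : 0 < `|L| + 1 by rewrite ltr_wpDl.
(* The step changes the form by at most [|l|], so its sign cannot flip; the added 1 keeps the
   denominator positive. *)
exists (`|l| / (`|L| + 1)); first by rewrite divr_gt0.
set t := _ / _; have t0 : 0 < t by rewrite divr_gt0.
have : `|t * L| <= `|l|.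
  by rewrite normrM gtr0_norm // mulrAC ler_pdivrMr // ler_wpM2l // lerDl.
rewrite ler_norml => /andP[tL1 tL2].
have lp : affine_form b a (z + t *: v) = l + t * L by rewrite affine_formDZ.
have lm : affine_form b a (z - t *: v) = l - t * L.
  by rewrite -scaleNr affine_formDZ mulNr.
have [lz|lz|lz] := ltgtP l 0; last by rewrite lz eqxx in z0.
- rewrite ltr0_norm // in tL1 tL2.
  by apply: (@second_diff_affine _ _ _ _ _ 0 0);
    rewrite affine_form0 /hinge ?lp ?lm max_l // -/l; lra.
- rewrite gtr0_norm // in tL1 tL2.
  by apply: (@second_diff_affine _ _ _ _ _ b a);
    rewrite /hinge max_r // ?lp ?lm -/l; lra.
Qed.

Lemma hinge_irreducible_factorization (R : realType) (d n : nat)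
    (b : 'I_n -> 'rV[R]_d) (a : 'I_n -> R) :
  (1 < n)%N -> (forall i, b i != 0) ->
  (forall i j, i != j ->
    exists2 z, affine_form (b i) (a i) z = 0 & affine_form (b j) (a j) z != 0) ->
  irreducible_factorization (hinge_sum 0 0 b a) (fun i => hinge (b i) (a i)).
Proof.
move=> n1 b0 zP; split=> [|i]; last exact: irreducible_hinge.
split.
- split=> [|i|x]; [exact: ltnW|exact: tropical_hinge|].
  by rewrite /hinge_sum affine_form0 add0r.
- move=> i j f ij fi fj.
  have [c [b1 [a1 [c0 fE]]]] := hinge_divisor (b0 i) fi.
  have [c' [b2 [a2 [_ fE']]]] := hinge_divisor (b0 j) fj.
  move: c0; rewrite le0r => /predU1P[c0|c0].
    by exists b1, a1 => x _; rewrite fE c0 mul0r add0r.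
  (* At a point on hyperplane [i] but off [j], [f] bends as [c] times hinge [i] and also not at all,
     as a multiple of hinge [j]; so [c] cannot be positive. *)
  have [z iz jz] := zP i j ij; have [t t0 jt] := second_diff_hinge0 (b i) jz.
  have : second_diff f z (t *: b i) = c * second_diff (hinge (b i) (a i)) z (t *: b i).
    by rewrite -(second_diff_comb _ _ _ b1 a1); congr second_diff; apply/funext.
  have -> : second_diff f z (t *: b i) = 0.
    transitivity (c' * second_diff (hinge (b j) (a j)) z (t *: b i)).
      by rewrite -(second_diff_comb _ _ _ b2 a2); congr second_diff; apply/funext.
    by rewrite jt mulr0.
  move=> /esym/eqP; rewrite mulf_eq0 !gt_eqF //; exact: second_diff_hinge.
left=> i [c [c0 iE]].
have [j ij] : exists j, j != i.
  pose k := if i == Ordinal (ltnW n1) then Ordinal n1 else Ordinal (ltnW n1).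
  exists k; rewrite /k; case: ifP => [/eqP ->//|/negbT].
  by rewrite eq_sym.
(* Here the product bends because of hinge [j], while its supposed power, hinge [i], does not. *)
have [z jz iz] := zP j i ij; have [t t0 it] := second_diff_hinge0 (b j) iz.
have := second_diff_hinge_sum 0 0 b a z (t *: b j) j.
have := second_diff_hinge (b0 j) t0 jz.
suff -> : second_diff (hinge_sum 0 0 b a) z (t *: b j) = 0 by move=> ? ?; lra.
apply/eqP; rewrite -(mulrI_eq0 _ (lregP (lt0r_neq0 c0))); apply/eqP.
rewrite -[RHS]it -(second_diff_comb _ _ _ 0 0); congr second_diff.
by apply/funext => x; rewrite affine_form0 addr0 iE.
Qed.

Lemma mComp_hinge (R : realType) (d : nat) (b : 'rV[R]_d.+1) (a : R) :
  b != 0 -> mComp (hinge b a) = 2%N.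
Proof.
move=> b0.
have -> : hinge b a = hinge_sum 0 0 (fun _ : 'I_1 => b) (fun _ => a).
  by apply/funext => x; rewrite /hinge_sum affine_form0 add0r big_ord1.
rewrite mComp_hinge_sum //.
rewrite (@card_parallel_cells _ _ _ _ _ (affine_form b a) (fun=> 0) (fun=> 1)) //.
- by rewrite card_ord.
- by move=> r; exact: affine_form_surj.
- by move=> i j _; rewrite !ord1.
- by move=> _ x; rewrite mul1r subr0.
Qed.

(** Each hinge has two regions, and 2n - (n - 1) = n + 1. *)
Lemma fComp_hinge (R : realType) (d n : nat) (b : 'I_n -> 'rV[R]_d.+1)
    (a : 'I_n -> R) :
  (0 < n)%N -> (forall i, b i != 0) -> fComp (fun i => hinge (b i) (a i)) = n.+1.
Proof.
move=> n0 b0; rewrite /fComp; under eq_bigr do rewrite mComp_hinge //.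
by rewrite sum_nat_const card_ord muln2 -addnn subnBA // addnAC addnK addn1.
Qed.

Lemma affine_form_delta (R : realType) (d : nat) (k : 'I_d) (a : R)
    (x : 'rV[R]_d) : affine_form (delta_mx 0 k) a x = x 0 k + a.
Proof.
rewrite /affine_form (bigD1 k) //= big1 ?addr0 => [|j jk].
  by rewrite mxE !eqxx mul1r.
by rewrite mxE (negPf jk) andbF mul0r.
Qed.

Lemma delta_mx_neq0 (R : realType) (d : nat) (k : 'I_d) :
  (delta_mx 0 k : 'rV[R]_d) != 0.
Proof.
by apply/eqP => /rowP/(_ k)/eqP; rewrite !mxE !eqxx oner_eq0.
Qed.

Lemma four_parallel_lines (R : realType) :
  let b := fun _ : 'I_4 => delta_mx 0 0 : 'rV[R]_2 in
  let a := fun i : 'I_4 => - (i%:R : R) in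
  irreducible_factorization (hinge_sum 0 0 b a) (fun i => hinge (b i) (a i)) /\
  mComp (hinge_sum 0 0 b a) = 5%N.
Proof.
move=> b a; have b0 i : b i != 0 by exact: delta_mx_neq0.
split.
  apply: hinge_irreducible_factorization => // i j ij.
  exists (const_mx i%:R); rewrite affine_form_delta mxE; first exact: subrr.
  by rewrite subr_eq0 eqr_nat.
rewrite mComp_hinge_sum //.
rewrite (@card_parallel_cells _ _ _ _ _ (fun x => x 0 0)
  (fun i : 'I_4 => i%:R) (fun=> 1)) //.
- by rewrite card_ord.
- by move=> r; exists (const_mx r); rewrite mxE.
- by move=> i j /eqP; rewrite eqr_nat => /eqP/val_inj.
- by move=> i x; rewrite affine_form_delta mul1r.
Qed.

(** Indices 0 and 1 give the lines x = 0 and x = 1, index 2 gives y = 0. For the comparison, six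
    nonempty cells suffice. *)
Lemma three_grid_lines (R : realType) :
  let b := fun i : 'I_3 => delta_mx 0 (if i == 2 :> nat then 1 else 0) : 'rV[R]_2 in
  let a := fun i : 'I_3 => if i == 2 :> nat then 0 else - (i%:R : R) in
  irreducible_factorization (hinge_sum 0 0 b a) (fun i => hinge (b i) (a i)) /\
  (5 < mComp (hinge_sum 0 0 b a))%N.
Proof.
move=> b a; have b0 i : b i != 0 by exact: delta_mx_neq0.
pose pt (p q : R) : 'rV[R]_2 := \row_k (if k == 0 then p else q).
have lE i p q : affine_form (b i) (a i) (pt p q) =
    if i == 2 :> nat then q else p - i%:R.
  by rewrite affine_form_delta mxE /a; case: (nat_of_ord i == 2) => //=; rewrite addr0.
split.
  apply: hinge_irreducible_factorization => // i j ij.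
  (* For [i] = 2 this is (2, 0), off both vertical lines; otherwise it is (i, 1), off the horizontal
     line and the other vertical one. *)
  exists (pt i%:R (i != 2 :> nat)%:R); rewrite lE.
    by case: eqP => //= _; rewrite subrr.
  case: (j =P 2 :> nat) => [j2|_]; last by rewrite subr_eq0 eqr_nat.
  by rewrite -{1}j2 ij oner_eq0.
rewrite mComp_hinge_sum //.
(* The first component counts the vertical lines to the left of the cell, the second is the sign of
   y. *)
pose phi (p : 'I_3 * bool) : {ffun 'I_3 -> bool} :=
  [ffun j : 'I_3 => if j == 2 :> nat then p.2 else (j < p.1)%N].
have phi_inj : injective phi.
  move=> [k e] [k' e'] /ffunP pE.
  have := pE (@Ordinal 3 0 isT); have := pE (@Ordinal 3 1 isT).
  have := pE (@Ordinal 3 2 isT); rewrite !ffunE /= => -> h1 h0; congr (_, _).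
  apply: val_inj; move: (ltn_ord k) (ltn_ord k') h0 h1 => /=.
  by case: (nat_of_ord k) => [|[|[|?]]]; case: (nat_of_ord k') => [|[|[|?]]].
have -> : 6%N = #|[set phi p | p : 'I_3 * bool]%SET|.
  by rewrite card_imset // card_prod card_ord card_bool.
apply: subset_leq_card; apply/fintype.subsetP => _ /imsetP[[k e] _ ->]; rewrite inE.
(* The abscissa k - 1/2 has exactly the vertical lines of index below [k] on its left. *)
apply/asboolP; exists (pt (k%:R - 2^-1) (if e then 1 else -1)) => j.
rewrite lE ffunE /=; case: (nat_of_ord j == 2); first by case: e; lra.
case: ltnP => jk.
  have : j.+1%:R <= k%:R :> R by rewrite ler_nat.
  by rewrite -natr1; lra.
have : k%:R <= j%:R :> R by rewrite ler_nat.
lra.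
Qed.

Theorem proposition10 (R : realType) :
  (forall (g : 'rV[R]_1 -> R) (m : nat) (h : 'I_m -> 'rV[R]_1 -> R),
     tropical_polynomial g ->
     nontrivial_factorization g h ->
     mComp g = fComp h)
  /\
  (exists (g h : 'rV[R]_2 -> R)
          (n : nat) (gs : 'I_n -> 'rV[R]_2 -> R)
          (m : nat) (hs : 'I_m -> 'rV[R]_2 -> R),
     [/\ tropical_polynomial g, tropical_polynomial h,
         irreducible_factorization g gs, irreducible_factorization h hs &
         (mComp g < mComp h)%N /\ (fComp hs < fComp gs)%N]).
Proof.
split=> [g m h _ [fgh hco _]|]; first exact: mComp_factorization1.
(* The parallel lines have 5 regions against at least 6 for the grid, while the factorization
   complexities are 5 and 4. *)
have [g_fact gE] := four_parallel_lines R.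
have [h_fact hE] := three_grid_lines R.
do 6?eexists; split; [| |exact: g_fact|exact: h_fact|split].
- exact: tropical_hinge_sum.
- exact: tropical_hinge_sum.
- by rewrite gE.
- by rewrite !fComp_hinge // => i; exact: delta_mx_neq0.
Qed.
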